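(* Let $L$ be a finite lattice with least element $0$ and greatest element $1$. Then the aggregation clone $\mathcal{C}_L$ on $L$ is generated by the lattice operations $\vee$ and $\wedge$, the unary functions $\chi_a$ for $a\in L$, and the binary functions $\oplus_b$ for $b\in L$.
   Context: An $n$-ary ($n\ge 1$) aggregation function on a bounded lattice $L$ with bounds $0,1$ is a map $A\colon L^n\to L$ that is monotone ($A(\mathbf{x})\le A(\mathbf{y})$ whenever $\mathbf{x}\le\mathbf{y}$ componentwise) and satisfies $A(0,\dots,0)=0$ and $A(1,\dots,1)=1$. The aggregation clone $\mathcal{C}_L$ is the set of all aggregation functions on $L$ of all arities $n\ge 1$. A clone on a set $A$ is a set of finitary operations on $A$ (arity $\ge 1$) that contains all projections $p_i^n(x_1,\dots,x_n)=x_i$ and is closed under composition: with $f$ $k$-ary and $g_1,\dots,g_k$ $n$-ary it contains the $n$-ary operation $f(g_1(x_1,\dots,x_n),\dots,g_k(x_1,\dots,x_n))$. The clone generated by a set $F$ of operations is the least clone containing $F$. For $a\in L$, $\chi_a\colon L\to L$ is defined by $\chi_a(x)=1$ if $x\ge a$ and $x\ne 0$, and $\chi_a(x)=0$ otherwise. For $b\in L$, $\oplus_b\colon L\times L\to L$ is defined by $x\oplus_b y=1$ if $x=y=1$; $x\oplus_b y=0$ if $x=y=0$; and $x\oplus_b y=b$ otherwise. *)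

(* Defs.v *)
From mathcomp Require Import all_boot all_order.

Set Implicit Arguments.
Unset Strict Implicit.
Unset Printing Implicit Defensive.

Import Order.TTheory.
Local Open Scope order_scope.

Definition operation (A : Type) (n : nat) : Type := n.-tuple A -> A.

Definition operation_set (A : Type) : Type := forall n, operation A n -> Prop.

Definition subset_op (A : Type) (F G : operation_set A) : Prop :=
  forall n (f : operation A n), F n f -> G n f.

Definition projection (A : Type) (n : nat) (i : 'I_n) : operation A n :=
  fun x => tnth x i.

Definition compose (A : Type) (k n : nat) (f : operation A k)
    (g : 'I_k -> operation A n) : operation A n :=
  fun x => f [tuple g i x | i < k].

(* A clone has no nullary operations: every arity is at least 1. *)
Record is_clone (A : Type) (C : operation_set A) : Prop := IsClone {
  clone_arity : forall n (f : operation A n), C n f -> (0 < n)%N;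
  clone_projection : forall n (i : 'I_n), C n (@projection A n i);
  clone_compose : forall k n (f : operation A k) (g : 'I_k -> operation A n),
    C k f -> (forall i, C n (g i)) -> C n (compose f g)
}.

Record clone_generated_by (A : Type) (F C : operation_set A) : Prop :=
    CloneGeneratedBy {
  generated_is_clone : is_clone C;
  generated_contains : subset_op F C;
  generated_least : forall D : operation_set A,
    is_clone D -> subset_op F D -> subset_op C D
}.

Definition unary (A : Type) (f : A -> A) : operation A 1 :=
  fun x => f (tnth x ord0).

Definition binary (A : Type) (f : A -> A -> A) : operation A 2 :=
  fun x => f (tnth x ord0) (tnth x ord_max).

Section Aggregation.

Variables (d : Order.disp_t) (L : tbLatticeType d).

Record aggregation_clone (n : nat) (f : operation L n) : Prop := Aggregation {
  aggregation_arity : (0 < n)%N;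
  aggregation_mono : forall x y : n.-tuple L,
    (forall i, tnth x i <= tnth y i) -> f x <= f y;
  aggregation_bot : f [tuple of nseq n \bot] = \bot;
  aggregation_top : f [tuple of nseq n \top] = \top
}.

Definition chi (a x : L) : L :=
  if (a <= x) && (x != \bot) then \top else \bot.

Definition oplus (b x y : L) : L :=
  if (x == \top) && (y == \top) then \top
  else if (x == \bot) && (y == \bot) then \bot
  else b.

Inductive generators : operation_set L :=
| gen_join : generators (binary (fun x y => x `|` y))
| gen_meet : generators (binary (fun x y => x `&` y))
| gen_chi (a : L) : generators (unary (chi a))
| gen_oplus (b : L) : generators (binary (oplus b)).

End Aggregation.

(* Main.v *)
(** An aggregation function [f] is the join of the step functions attached to
    the nonzero points [a] of [L^n]: the step at [a] takes the value [f a] on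
    the up-set of [a], except for [\top] at the constant tuple [\top], and
    [\bot] elsewhere. The indicator of the up-set of [a] is the meet of the
    [chi (a_i)(x_i)] over those [i] with [a_i != \bot], and the step at [a] is
    its [oplus (f a)] with the indicator of the up-set of the top tuple. *)
Require Import Defs.
From mathcomp Require Import all_boot all_order.
From Stdlib Require Import FunctionalExtensionality.

Set Implicit Arguments.
Unset Strict Implicit.
Unset Printing Implicit Defensive.

Import Order.TTheory.
Local Open Scope order_scope.

Section CloneClosure.
Variables (A : Type) (C : operation_set A).
Hypothesis cloneC : is_clone C.

Lemma clone_unary n (u : A -> A) (f : operation A n) :
  C (unary u) -> C f -> C (fun x => u (f x)).
Proof.
move=> Cu Cf; have := clone_compose cloneC (g := fun=> f) Cu (fun=> Cf).
congr (C _); apply: functional_extensionality => x.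
by rewrite /compose /unary tnth_mktuple.
Qed.

Lemma clone_binary n (op : A -> A -> A) (f g : operation A n) :
  C (binary op) -> C f -> C g -> C (fun x => op (f x) (g x)).
Proof.
move=> Cop Cf Cg.
have Ch (i : 'I_2) : C (if i == ord0 then f else g) by case: ifP.
have := clone_compose cloneC Cop Ch.
congr (C _); apply: functional_extensionality => x.
by rewrite /compose /binary !tnth_mktuple.
Qed.

(* The index range must be inhabited: a clone need not contain [idx]. *)
Lemma clone_big n (idx : A) (op : Monoid.law idx) (I : finType) (P : pred I)
    (h : I -> operation A n) (i0 : I) :
    C (binary op) -> P i0 -> (forall i, P i -> C (h i)) ->
  C (fun x => \big[op/idx]_(i | P i) h i x).
Proof.
move=> Cop Pi0 Ch.
pose s := [seq i <- index_enum I | P i].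
have -> : (fun x => \big[op/idx]_(i | P i) h i x) =
          (fun x => \big[op/idx]_(i <- s) h i x).
  by apply: functional_extensionality => x; rewrite big_filter.
have sP : {subset s <= P} by move=> i; rewrite mem_filter => /andP[].
have : i0 \in s by rewrite mem_filter Pi0 mem_index_enum.
have : s != [::] -> C (fun x => \big[op/idx]_(i <- s) h i x).
  (* The induction starts at one-element lists, where the unit law leaves the single term, so [idx]
     itself never has to lie in [C]. *)
  elim: s sP => // i [|j s] IHs sP _.
    have := Ch i (sP i (mem_head _ _)).
    by congr (C _); apply: functional_extensionality => x; rewrite big_seq1.
  have Cs : C (fun x => \big[op/idx]_(k <- j :: s) h k x).
    by apply: IHs => // k ks; apply: sP; rewrite inE ks orbT.
  have := clone_binary Cop (Ch i (sP i (mem_head _ _))) Cs.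
  by congr (C _); apply: functional_extensionality => x; rewrite [RHS]big_cons.
by case: (s) => // i s' Cs _; apply: Cs.
Qed.

End CloneClosure.

Section AggregationClone.
Variables (d : Order.disp_t) (L : tbLatticeType d).

Lemma aggregation_is_clone : is_clone (@aggregation_clone d L).
Proof.
split=> [n f [] //|n i|k n f g aggf aggg].
  split=> [|x y le_xy||]; rewrite /projection ?tnth_nseq //.
  by case: n i => // -[].
have [k0 monof f0 f1] := aggf.
split=> [|x y le_xy||].
- by case: (aggg (Ordinal k0)).
- apply: monof => i; rewrite !tnth_mktuple.
  by case: (aggg i) => _ monog _ _; apply: monog.
- rewrite -[RHS]f0; congr f; apply: eq_from_tnth => i.
  by rewrite tnth_mktuple tnth_nseq; case: (aggg i).
- rewrite -[RHS]f1; congr f; apply: eq_from_tnth => i.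
  by rewrite tnth_mktuple tnth_nseq; case: (aggg i).
Qed.

Lemma chi_mono (a : L) : {homo chi a : x y / x <= y}.
Proof.
move=> x y le_xy; rewrite /chi.
case: ifP => [/andP[ax x0]|_]; last exact: le0x.
rewrite (le_trans ax le_xy) /=; case: eqP => [y0|_]; last exact: lexx.
by move: le_xy; rewrite y0 lex0 (negPf x0).
Qed.

(** Away from the least and greatest pairs the value is the constant [b], which lies between the
    values [\bot] and [\top] taken there. *)
Lemma oplus_mono (b x y x' y' : L) :
  x <= x' -> y <= y' -> oplus b x y <= oplus b x' y'.
Proof.
move=> xx' yy'; rewrite /oplus.
case: ifP => [/andP[/eqP x1 /eqP y1]|_].
  by move: xx' yy'; rewrite x1 y1 !le1x => -> ->.
case: ifP => [_|n0]; first exact: le0x.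
case: ifP => _; first exact: lex1.
case: ifP => [/andP[/eqP x'0 /eqP y'0]|_]; last exact: lexx.
by move: xx' yy' n0; rewrite x'0 y'0 !lex0 => -> ->.
Qed.

Lemma generators_aggregation :
  subset_op (@generators d L) (@aggregation_clone d L).
Proof.
move=> n f [||a|b]; split=> // [x y le_xy||];
  rewrite /binary /unary ?tnth_nseq.
- exact: leU2.
- exact: joinxx.
- exact: joinxx.
- exact: leI2.
- exact: meetxx.
- exact: meetxx.
- exact: chi_mono.
- by rewrite /chi eqxx andbF.
- rewrite /chi lex1 /=; by case: eqP.
- exact: oplus_mono.
- by rewrite /oplus eqxx /=; case: eqP.
- by rewrite /oplus eqxx.
Qed.

(** If [a_i != \bot], then [a_i <= x_i] forces [x_i != \bot], so [chi (a_i)] is the plain indicator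
    of an up-set. Coordinates with [a_i = \bot] impose no condition and must be skipped, since
    [chi \bot] still sends [\bot] to [\bot]. *)
Lemma meet_chiE n (a x : n.-tuple L) :
  \meet_(i | tnth a i != \bot) chi (tnth a i) (tnth x i) =
    if [forall i, tnth a i <= tnth x i] then \top else \bot.
Proof.
case: ifP => [/forallP le_ax|/negbT].
  apply: big1 => i ai0; rewrite /chi le_ax /=; case: eqP => // xi0.
  by have := le_ax i; rewrite xi0 lex0 (negPf ai0).
rewrite negb_forall => /existsP[i Nle]; apply/eqP; rewrite -lex0.
have ai0 : tnth a i != \bot by apply: contraNneq Nle => ->; apply: le0x.
by rewrite (bigD1 i) //= {1}/chi (negPf Nle) /= meet0x.
Qed.

End AggregationClone.

Section Generation.
Variables (d : Order.disp_t) (L : finTBLatticeType d).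
Variables (n : nat) (f : operation L n).
Hypothesis aggf : aggregation_clone f.

Let point_meet (a x : n.-tuple L) : L :=
  \meet_(i | tnth a i != \bot) chi (tnth a i) (tnth x i).

(** When [\bot != \top], [oplus (f a)] receives [(\top, \top)] at the top tuple, [(\top, \bot)]
    elsewhere on the up-set of [a], and [(\bot, \bot)] off it. *)
Let step (a x : n.-tuple L) : L :=
  oplus (f a) (point_meet a x) (point_meet [tuple of nseq n \top] x).

(** At the zero tuple [point_meet] is an empty meet, the constant [\top], which is not an
    aggregation function when [\bot != \top]. *)
Let nonzero (a : n.-tuple L) := [exists i, tnth a i != \bot].

Lemma forall_top_le (x : n.-tuple L) :
  [forall i, tnth [tuple of nseq n (\top : L)] i <= tnth x i] =
  (x == [tuple of nseq n \top]).
Proof.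
apply/forallP/eqP => [le1|->] // ; apply: eq_from_tnth => i.
by apply/eqP; have := le1 i; rewrite !tnth_nseq le1x.
Qed.

(** Monotonicity keeps every step below [f], and the step at [x] itself reaches [f x]. *)
Lemma join_stepE (x : n.-tuple L) :
  (\bot : L) != \top -> f x = \join_(a | nonzero a) step a x.
Proof.
move=> n01; have [_ monof f0 f1] := aggf.
have n10 : (\top : L) != \bot by rewrite eq_sym.
have stepE a : step a x = if [forall i, tnth a i <= tnth x i] then
    if x == [tuple of nseq n \top] then \top else f a else \bot.
  rewrite /step /point_meet !meet_chiE forall_top_le /oplus.
  have [->|_] := eqVneq x [tuple of nseq n \top].
    have -> : [forall i, tnth a i <= tnth [tuple of nseq n (\top : L)] i].
      by apply/forallP => i; rewrite tnth_nseq lex1.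
    by rewrite eqxx.
  by case: [forall i, _]; rewrite ?eqxx ?(negPf n01) ?(negPf n10).
apply/le_anti/andP; split; last first.
  apply/joinsP => a _; rewrite stepE; case: ifP => [/forallP le_ax|_]; last exact: le0x.
  by case: eqP => [->|_]; [rewrite f1 | apply: monof].
have [x0|] := boolP (nonzero x).
  apply: le_trans (joins_sup _ x0); rewrite stepE.
  have -> : [forall i, tnth x i <= tnth x i] by apply/forallP.
  by case: eqP => [->|//]; rewrite lex1.
(* The zero tuple has no step of its own in the join, but there [f] is [\bot]. *)
rewrite negb_exists => /forallP x0.
suff -> : x = [tuple of nseq n \bot] by rewrite f0 le0x.
by apply: eq_from_tnth => i; rewrite tnth_nseq; apply/eqP/negPn.
Qed.

Lemma aggregation_generated (D : operation_set L) :
  is_clone D -> subset_op (@generators d L) D -> D n f.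
Proof.
move=> cloneD genD; have [n0 _ _ _] := aggf; pose i0 := Ordinal n0.
(* On a one-element lattice all operations of one arity coincide, so [f] is a projection. *)
have [e01|n01] := eqVneq (\bot : L) \top.
  have := clone_projection cloneD i0.
  congr (D _ _); apply: functional_extensionality => x.
  have all0 (y : L) : y = \bot by apply/eqP; rewrite -lex0 e01 lex1.
  by rewrite [LHS]all0 [RHS]all0.
have Dmeet a : nonzero a -> D n (point_meet a).
  move=> /existsP[i ai0].
  apply: (clone_big (h := fun i x => chi (tnth a i) (tnth x i)) cloneD _ ai0).
    exact: genD (gen_meet L).
  move=> j _; apply: (clone_unary cloneD); first exact: genD (gen_chi _).
  exact: clone_projection.
(* The top tuple shows that the join is not empty, and its indicator enters every step. *)
have nz1 : nonzero [tuple of nseq n \top].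
  by apply/existsP; exists i0; rewrite tnth_nseq eq_sym.
have -> : f = fun x => \join_(a | nonzero a) step a x.
  by apply: functional_extensionality => x; apply: join_stepE.
apply: (clone_big (h := step) cloneD _ nz1) => [|a nza]; first exact: genD (gen_join L).
by apply: clone_binary; [|exact: genD (gen_oplus _)|exact: Dmeet|exact: Dmeet].
Qed.

End Generation.

Theorem theorem3p5 (d : Order.disp_t) (L : finTBLatticeType d) :
  clone_generated_by (@generators d L) (@aggregation_clone d L).
Proof.
split; [exact: aggregation_is_clone | exact: generators_aggregation |].
by move=> D cloneD genD n f aggf; apply: aggregation_generated.
Qed.
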